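(* Consider two-armed Gaussian batch bandits with fixed counts $\mathbf n=(n_1,n_2)$, $n_1,n_2>0$, and let $n_{\min}=\min(n_1,n_2)$. Let $c_0>0$ be a constant such that $\inf_{\mathcal A}\sup_{\theta\in\Theta_{\mathbf n}}\mathcal R(\mathcal A,\theta)\ge c_0/\sqrt{n_{\min}}$. Then for any $c>2/c_0$ and any algorithm $\mathcal A$, $$\sup_{\theta\in\Theta_{\mathbf n}}\frac{\mathcal R(\mathcal A,\theta)}{\mathcal R^*_{\mathcal M_{\mathbf n,c}}(\theta)}\ \ge\ \frac{n_{\min}}{n_{\min}+4}\,e^{\frac{\beta^2}{4}+\frac{\beta}{4}\sqrt{n_{\min}}},\qquad\text{where }\beta=cc_0-2.$$
   Context: Setting: two arms ($k=2$), counts $\mathbf n=(n_1,n_2)$ (positive, not necessarily integers). An instance $\theta\in\Theta_{\mathbf n}$ is a pair of means $(\mu_1,\mu_2)\in[0,1]^2$; the data are the independent sufficient statistics $X_1\sim\mathcal N(\mu_1,1/n_1)$, $X_2\sim\mathcal N(\mu_2,1/n_2)$ (empirical means of unit-variance Gaussian rewards), together with $\mathbf n$. An algorithm $\mathcal A$ maps $X=(X_1,X_2,\mathbf n)$ to a (possibly randomized) arm $\mathcal A(X)\in\{1,2\}$. Its simple regret is $\mathcal R(\mathcal A,\theta)=\max(\mu_1,\mu_2)-\mathbb E_{X\sim\theta}[\mu_{\mathcal A(X)}]$. For $c\ge1$, the set of minimax optimal algorithms (up to factor $c$) is $\mathcal M_{\mathbf n,c}=\{\mathcal A:\sup_{\theta\in\Theta_{\mathbf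 n}}\mathcal R(\mathcal A,\theta)\le c\cdot\inf_{\mathcal A'}\sup_{\theta\in\Theta_{\mathbf n}}\mathcal R(\mathcal A',\theta)\}$. For a set $\mathcal M$ of algorithms, the instance-dependent lower bound is $\mathcal R^*_{\mathcal M}(\theta)=\inf_{\mathcal A\in\mathcal M}\mathcal R(\mathcal A,\theta)$. Ratios use the conventions $x/0=+\infty$ for $x>0$ and $0/0=0$. *)

(* Defs.v *)
(* MathComp-Analysis, over an arbitrary [R : realType]. *)
From mathcomp Require Import all_boot all_order all_algebra.
From mathcomp Require Import all_classical all_reals all_analysis.

Set Implicit Arguments.
Unset Strict Implicit.
Unset Printing Implicit Defensive.

Import Order.TTheory GRing.Theory Num.Theory.
Import numFieldNormedType.Exports.

Local Open Scope classical_set_scope.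
Local Open Scope ring_scope.

(* The two arms are the booleans: [true] is arm 1 and [false] is arm 2.
   Pairs [n = (n_1, n_2)] and [theta = (mu_1, mu_2)] are indexed accordingly. *)
Definition arm_mean (R : realType) (theta : R * R) (a : bool) : R :=
  if a then theta.1 else theta.2.

Definition instances (R : realType) : set (R * R) := `[0, 1] `*` `[0, 1].

(* [normal_prob m s] has standard deviation [s], hence variance [1 / n_i] for
   [s = (sqrt n_i)^-1] with [n_i > 0]. *)
Definition obs_law (R : realType) (n theta : R * R) :
    set (measurableTypeR R * measurableTypeR R) -> \bar R :=
  (normal_prob theta.1 (Num.sqrt n.1)^-1 \x
   normal_prob theta.2 (Num.sqrt n.2)^-1)%E.

(* A randomized algorithm sends the counts [n] and the empirical means
   [(X_1, X_2)] to a distribution on the arms; for each [n] it is a Markov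
   kernel in [(X_1, X_2)]. No regularity in [n] is required. *)
Definition algorithm (R : realType) :=
  R * R -> R.-pker (measurableTypeR R * measurableTypeR R) ~> bool.

Definition regret (R : realType) (n : R * R) (A : algorithm R)
    (theta : R * R) : \bar R :=
  ((Num.max theta.1 theta.2)%:E
   - \int[obs_law n theta]_x \int[A n x]_a (arm_mean theta a)%:E)%E.

Definition worst_regret (R : realType) (n : R * R) (A : algorithm R) : \bar R :=
  ereal_sup [set regret n A theta | theta in @instances R].

Definition minimax_regret (R : realType) (n : R * R) : \bar R :=
  ereal_inf [set worst_regret n A | A in @setT (algorithm R)].

Definition minimax_optimal (R : realType) (n : R * R) (c : R) :
    set (algorithm R) :=
  [set A | (worst_regret n A <= c%:E * minimax_regret n)%E].

Definition instance_lower_bound (R : realType) (n : R * R)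
    (M : set (algorithm R)) (theta : R * R) : \bar R :=
  ereal_inf [set regret n A theta | A in M].

(* Division in [\bar R] satisfies [0^-1 = +oo] and [0 * +oo = 0], so that
   [x / 0 = +oo] for [x > 0] and [0 / 0 = 0]. *)
Definition regret_ratio (R : realType) (n : R * R) (c : R) (A : algorithm R)
    (theta : R * R) : \bar R :=
  (regret n A theta
   / instance_lower_bound n (minimax_optimal n c) theta)%E.

(* Main.v *)
(* Write gap x = x_1 - x_2 and kappa = n_1 n_2 / (n_1 + n_2), the inverse
   variance of gap X. Moving the means along the direction (1/n_1, -1/n_2)
   multiplies the density of X by a function of gap X only.

   The two algorithms that discard one fixed arm b when its empirical gap over
   the other arm is below -y, with y = beta / sqrt nmin, have worst-case regret
   at most (beta + 1) / sqrt nmin by a Chernoff bound, hence are minimax optimal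
   up to c.

   Take two instances with gaps 1/2 and -1/2 that differ along this direction.
   By Neyman-Pearson, the error probabilities of any A on them add up to at
   least those of the test by the sign of gap X, so that A does at least as badly
   as this test on one of them. On that instance the algorithm favouring the best
   arm errs when the gap is below -y instead of 0; translating the Gaussian by y
   gains a factor exp (kappa y (1/2 + y/2)), and kappa >= nmin / 2. *)
Require Import Defs.
From HB Require Import structures.
From mathcomp Require Import all_boot all_order all_algebra.
From mathcomp Require Import all_classical all_reals all_analysis.
From mathcomp Require Import measurable_realfun ring lra.

Import Order.TTheory GRing.Theory Num.Theory.
Import numFieldNormedType.Exports.

Local Open Scope classical_set_scope.
Local Open Scope ring_scope.

Set Implicit Arguments.
Unset Strict Implicit.
Unset Printing Implicit Defensive.

(** * Order and integration in the extended reals *)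

(** Pigeonhole that extracts, from a bound on the sum of two error probabilities, one instance on
    which the algorithm does badly. *)
Lemma leeD_or (R : realDomainType) (a b a' b' : \bar R) :
  (a + b <= a' + b')%E -> (a <= a')%E \/ (b <= b')%E.
Proof.
move=> le_ab; have [aa'|a'a] := leP a a'; first by left.
right; rewrite leNgt; apply/negP => b'b.
by move: le_ab; rewrite leNgt lteD.
Qed.

Lemma integral_indicT (R : realType) d (T : measurableType d)
    (mu : {measure set T -> \bar R}) (E : set T) :
  measurable E -> (\int[mu]_x (\1_E x)%:E = mu E)%E.
Proof. by move=> mE; rewrite integral_indic// setIT. Qed.

(** Serves twice in the computation of the regret: over the arm drawn, then over the observation. *)
Lemma integral_cst_subZ (R : realType) d (T : measurableType d)
    (mu : {measure set T -> \bar R}) (F : T -> \bar R) (m g : R) :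
  mu setT = 1%E -> measurable_fun setT F -> (forall z, 0 <= F z <= 1)%E ->
  (\int[mu]_z (m%:E - g%:E * F z) = m%:E - g%:E * \int[mu]_z F z)%E.
Proof.
move=> mu1 mF F01.
have intc (k : R) : mu.-integrable setT (cst k%:E).
  apply/integrableP; split; first exact: measurable_cst.
  by rewrite /= integral_cst// mu1 mule1 ltry.
have intF : mu.-integrable setT F.
  apply: (le_integrable _ _ _ (intc 1)) => //= x _.
  by have /andP[F0 F1] := F01 x; rewrite gee0_abs// normr1.
rewrite (integralB _ (intc m))//; last exact: integrableZl.
by rewrite integral_cst// mu1 mule1 integralZl.
Qed.

(** * Translation and likelihood ratio of a one-dimensional Gaussian *)

Section normal_change_of_measure.
Context {R : realType}.
Implicit Types (m s a : R) (f : R -> \bar R).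
Local Notation mu := (@lebesgue_measure R).

Lemma measurable_addr a :
  measurable_fun [set: measurableTypeR R]
    (fun x : measurableTypeR R => x + a : measurableTypeR R).
Proof. exact: measurable_funD. Qed.

(** By uniqueness of Lebesgue measure it suffices to compare both sides on half-open intervals. *)
Lemma lebesgue_measureD a (A : set (measurableTypeR R)) : measurable A ->
  pushforward mu (fun x : measurableTypeR R => x + a : measurableTypeR R) A
  = mu A.
Proof.
move=> mA; apply/esym.
have ma := measurable_addr a.
apply: (@lebesgue_measure_unique R
  (pushforward mu (fun x : measurableTypeR R => x + a : measurableTypeR R))) => //.
move=> _ [[u v]] _ <-.
transitivity (mu `]u - a, v - a]%classic).
  rewrite !lebesgue_measure_itv/= !lte_fin ltrBlDr subrK.
  by rewrite -!EFinB opprB addrA subrK.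
congr (mu _).
by apply/seteqP; split => x /=; rewrite !in_itv/= ltrBlDr lerBrDr.
Qed.

(** The Radon-Nikodym derivative and [normal_pdf] have the same integral over every measurable set,
    hence agree almost everywhere. *)
Lemma ge0_integral_normal_prob m s f : s != 0 ->
  measurable_fun [set: R] f -> (forall x, 0 <= f x)%E ->
  (\int[normal_prob m s]_x f x = \int[mu]_x (f x * (normal_pdf m s x)%:E))%E.
Proof.
move=> s0 mf f0.
have dom := normal_prob_dominates m s.
rewrite -(Radon_Nikodym_SigmaFinite.change_of_variables dom)//.
have mg : mu.-integrable setT
    (Radon_Nikodym_SigmaFinite.f (normal_prob m s) mu).
  exact: Radon_Nikodym_SigmaFinite.f_integrable.
have mpdf : measurable_fun [set: R] (EFin \o normal_pdf m s).
  by apply/measurable_EFinP; exact: measurable_normal_pdf.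
apply: ge0_ae_eq_integral => //.
- by apply: emeasurable_funM => //; exact: measurable_int mg.
- exact: emeasurable_funM.
- by move=> x _; rewrite mule_ge0//; exact: Radon_Nikodym_SigmaFinite.f_ge0.
- by move=> x _; rewrite mule_ge0// lee_fin normal_pdf_ge0.
- apply: ae_eqe_mul2l; apply: integral_ae_eq => // E _ mE.
  by rewrite -Radon_Nikodym_SigmaFinite.f_integral.
Qed.

Lemma ge0_integral_normal_probD m s a f : s != 0 ->
  measurable_fun [set: R] f -> (forall x, 0 <= f x)%E ->
  (\int[normal_prob (m + a) s]_x f x = \int[normal_prob m s]_x f (x + a)%R)%E.
Proof.
move=> s0 mf f0.
have ma := measurable_addr a.
rewrite !ge0_integral_normal_prob//; last exact: measurableT_comp mf ma.
under [RHS]eq_integral => x _.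
  rewrite (_ : normal_pdf m s x = normal_pdf (m + a) s (x + a)); last first.
    by rewrite !normal_pdfE// /normal_fun opprD addrACA subrr addr0.
  over.
have mpdf : measurable_fun [set: R] (EFin \o normal_pdf (m + a) s).
  by apply/measurable_EFinP; exact: measurable_normal_pdf.
have := @ge0_integral_pushforward _ _ _ _ R _ ma mu setT
  (fun x => f x * (normal_pdf (m + a) s x)%:E)%E measurableT.
rewrite preimage_setT => <-.
- by apply: eq_measure_integral => A mA _; exact/esym/lebesgue_measureD.
- exact: emeasurable_funM.
- by move=> x _; rewrite mule_ge0// lee_fin normal_pdf_ge0.
Qed.

(** The exponent is the difference of the two quadratic exponents,
    [((x - m)^2 - (x - m - a)^2) / (2 s^2)]. *)
Lemma ge0_integral_normal_prob_ratio m s a f : s != 0 ->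
  measurable_fun [set: R] f -> (forall x, 0 <= f x)%E ->
  (\int[normal_prob (m + a) s]_x f x =
   \int[normal_prob m s]_x
     (f x * (expR (s ^- 2 * (a * (x - m) - a ^+ 2 / 2)))%:E))%E.
Proof.
move=> s0 mf f0.
have mexp : measurable_fun [set: R]
    (EFin \o (fun x => expR (s ^- 2 * (a * (x - m) - a ^+ 2 / 2)))).
  apply/measurable_EFinP; apply: measurableT_comp => //.
  apply: measurable_funM => //; apply: measurable_funB => //.
  by apply: measurable_funM => //; exact: measurable_funB.
rewrite !ge0_integral_normal_prob//; first last.
- by move=> x; rewrite mule_ge0// lee_fin expR_ge0.
- exact: emeasurable_funM.
apply: eq_integral => x _; rewrite -muleA -EFinM; congr (_ * _%:E)%E.
rewrite !normal_pdfE// mulrCA /normal_fun -expRD; congr (_ * expR _).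
by field.
Qed.

End normal_change_of_measure.

HB.instance Definition _ (R : realType) (n theta : R * R) :=
  Probability.on (obs_law n theta).

(** Used for true means and for observations alike; the index [b] lets both arms be treated by one
    argument. *)
HB.lock Definition gap (R : realType) (x : R * R) (b : bool) : R :=
  arm_mean x b - arm_mean x (~~ b).
Arguments gap {R} x%_R b.

#[local] Opaque obs_law normal_prob integral.

(** * Change of measure for the pair of empirical means *)

Section two_arms.
Context {R : realType}.
Implicit Types (n theta x w : R * R) (b : bool) (t y : R).
Local Notation obs := (measurableTypeR R * measurableTypeR R)%type.
Implicit Types f : obs -> \bar R.

Lemma obs_sd_neq0 r : 0 < r -> (Num.sqrt r)^-1 != 0 :> R.
Proof. by move=> r0; rewrite invr_neq0// gt_eqF// sqrtr_gt0. Qed.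

Lemma ge0_integral_obs_law n theta f :
  measurable_fun setT f -> (forall x, 0 <= f x)%E ->
  (\int[obs_law n theta]_x f x =
   \int[normal_prob theta.1 (Num.sqrt n.1)^-1]_u
     \int[normal_prob theta.2 (Num.sqrt n.2)^-1]_v f (u, v))%E.
Proof. by move=> mf f0; exact: fubini_tonelli1. Qed.

Lemma ge0_integral_obs_lawD n theta w f : 0 < n.1 -> 0 < n.2 ->
  measurable_fun setT f -> (forall x, 0 <= f x)%E ->
  (\int[obs_law n (theta.1 + w.1, theta.2 + w.2)%R]_x f x =
   \int[obs_law n theta]_x f (x.1 + w.1, x.2 + w.2)%R)%E.
Proof.
move=> n1 n2 mf f0.
have mfw : measurable_fun setT (fun x : obs => f (x.1 + w.1, x.2 + w.2)).
  apply: (measurableT_comp mf); apply: measurable_fun_pair => /=.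
    exact: measurable_funD.
  exact: measurable_funD.
apply: etrans (ge0_integral_obs_law _ _ mf f0) _ => /=.
apply/esym.
have f0w (x : obs) : (0 <= f (x.1 + w.1, x.2 + w.2)%R)%E by exact: f0.
apply: etrans (ge0_integral_obs_law n theta mfw f0w) _.
pose G u := (\int[normal_prob (theta.2 + w.2) (Num.sqrt n.2)^-1]_v f (u, v))%E.
have mG : measurable_fun [set: R] G by apply: measurable_fun_fubini_tonelli_F.
have G0 u : (0 <= G u)%E by apply: integral_ge0.
apply/esym; apply: etrans
  (ge0_integral_normal_probD theta.1 w.1 (obs_sd_neq0 n1) mG G0) _.
apply: eq_integral => u _.
exact: (ge0_integral_normal_probD theta.2 w.2 (obs_sd_neq0 n2)
  (measurable_fun_pair2 (u + w.1) mf)).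
Qed.

(** The coordinates are independent, so the ratio is a product and, by Tonelli, the one-dimensional
    formula applies to each coordinate in turn. *)
Lemma ge0_integral_obs_law_ratio n theta w f : 0 < n.1 -> 0 < n.2 ->
  measurable_fun setT f -> (forall x, 0 <= f x)%E ->
  (\int[obs_law n (theta.1 + w.1, theta.2 + w.2)%R]_x f x =
   \int[obs_law n theta]_x (f x * (expR
     (n.1 * (w.1 * (x.1 - theta.1) - w.1 ^+ 2 / 2) +
      n.2 * (w.2 * (x.2 - theta.2) - w.2 ^+ 2 / 2)))%:E))%E.
Proof.
move=> n1 n2 mf f0.
pose e1 (u : R) := expR (n.1 * (w.1 * (u - theta.1) - w.1 ^+ 2 / 2)).
pose e2 (v : R) := expR (n.2 * (w.2 * (v - theta.2) - w.2 ^+ 2 / 2)).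
have me (k v m : R) : measurable_fun [set: R]
    (EFin \o (fun x : R => expR (k * (v * (x - m) - v ^+ 2 / 2)))).
  apply/measurable_EFinP; apply: measurableT_comp; first by [].
  apply: measurable_funM; first by [].
  apply: measurable_funB; last by [].
  by apply: measurable_funM; last exact: measurable_funB.
have sE r : 0 < r -> (Num.sqrt r)^-1 ^- 2 = r :> R.
  by move=> r0; rewrite exprVn invrK sqr_sqrtr// ltW.
under [RHS]eq_integral => x _.
  rewrite expRD -/(e1 _) -/(e2 _) [e1 _ * _]mulrC EFinM muleA.
  over.
have mfe : measurable_fun setT (fun x : obs => (f x * (e2 x.2)%:E)%E).
  apply: emeasurable_funM; first by [].
  exact: (measurableT_comp (me _ _ _) measurable_snd).
have mg : measurable_fun setT
    (fun x : obs => (f x * (e2 x.2)%:E * (e1 x.1)%:E)%E).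
  apply: emeasurable_funM; first by [].
  exact: (measurableT_comp (me _ _ _) measurable_fst).
have fe0 x : (0 <= f x * (e2 x.2)%:E)%E by rewrite mule_ge0// lee_fin expR_ge0.
have g0 x : (0 <= f x * (e2 x.2)%:E * (e1 x.1)%:E)%E.
  by rewrite mule_ge0// lee_fin expR_ge0.
apply/esym; apply: etrans (ge0_integral_obs_law n theta mg g0) _.
apply/esym; apply: etrans (ge0_integral_obs_law _ _ mf f0) _.
pose G u := (\int[normal_prob (theta.2 + w.2) (Num.sqrt n.2)^-1]_v f (u, v))%E.
have mG : measurable_fun [set: R] G by apply: measurable_fun_fubini_tonelli_F.
have G0 u : (0 <= G u)%E by apply: integral_ge0.
apply: etrans
  (ge0_integral_normal_prob_ratio theta.1 w.1 (obs_sd_neq0 n1) mG G0) _.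
apply: eq_integral => u _.
have fev0 v : [set: R] v -> (0 <= f (u, v) * (e2 v)%:E)%E.
  by move=> _; exact: (fe0 (u, v)).
have eu0 : (0 <= (e1 u)%:E)%E by rewrite lee_fin expR_ge0.
have GE : G u =
    (\int[normal_prob theta.2 (Num.sqrt n.2)^-1]_v (f (u, v) * (e2 v)%:E))%E.
  apply: etrans (ge0_integral_normal_prob_ratio theta.2 w.2
    (obs_sd_neq0 n2) (measurable_fun_pair2 u mf) (fun v => f0 (u, v))) _.
  by apply: eq_integral => v _; rewrite sE.
rewrite GE (sE _ n1).
exact: esym (ge0_integralZr (normal_prob theta.2 (Num.sqrt n.2)^-1) measurableT
  (measurable_fun_pair2 u mfe) fev0 eu0).
Qed.

(** * The empirical gap and the displacement along which it is sufficient *)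

(* Inverse of [1 / n.1 + 1 / n.2], the variance of [X_1 - X_2]. *)
Definition precision n : R := n.1 * n.2 / (n.1 + n.2).

(* The displacement of [theta] that changes [gap theta b] by [t] at the least
   Kullback-Leibler cost. Along it the likelihood ratio depends on the
   observation [x] only through [gap x b]. *)
Definition gap_step n b t : R * R :=
  ((if b then t else - t) * n.2 / (n.1 + n.2),
   - ((if b then t else - t) * n.1 / (n.1 + n.2))).

Lemma gapN x b : gap x (~~ b) = - gap x b.
Proof. by rewrite !gap.unlock negbK opprB. Qed.

Lemma exists_best_arm theta : exists b, 0 <= gap theta b.
Proof.
have [h|h] := leP 0 (gap theta true); first by exists true.
by exists false; rewrite -(negbK false) gapN oppr_ge0 ltW.
Qed.

Lemma measurable_gap b : measurable_fun [set: obs] (gap^~ b).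
Proof.
rewrite gap.unlock; case: b.
  exact: (measurable_funB measurable_fst measurable_snd).
exact: (measurable_funB measurable_snd measurable_fst).
Qed.

Lemma measurable_gap_lr k b g t :
  measurable_fun [set: obs] (fun x => (expR (k * (gap x b - g - t)))%:E).
Proof.
apply/measurable_EFinP; apply: measurableT_comp; first by [].
apply: measurable_funM; first by [].
apply: measurable_funB; last by [].
by apply: measurable_funB; [exact: measurable_gap|].
Qed.

Lemma gap_stepE n x b t : 0 < n.1 -> 0 < n.2 ->
  gap (x.1 + (gap_step n b t).1, x.2 + (gap_step n b t).2) b = gap x b + t.
Proof.
move=> n1 n2; case: b; rewrite !gap.unlock /gap_step/=; field;
  by rewrite gt_eqF ?addr_gt0.
Qed.

(** For [b = true], [n.1 * w.1 = precision n * t = - (n.2 * w.2)], so the linear terms combine into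
    the gap; and [n.1 * w.1 ^+ 2 + n.2 * w.2 ^+ 2 = precision n * t ^+ 2]. The other arm reverses
    signs. *)
Lemma gap_step_log_ratio n theta x b t : 0 < n.1 -> 0 < n.2 ->
  let w := gap_step n b t in
  n.1 * (w.1 * (x.1 - theta.1) - w.1 ^+ 2 / 2) +
  n.2 * (w.2 * (x.2 - theta.2) - w.2 ^+ 2 / 2) =
  precision n * t * (gap x b - gap theta b - t / 2).
Proof.
move=> n1 n2 /=; case: b; rewrite !gap.unlock /gap_step /precision/=; field;
  by rewrite gt_eqF ?addr_gt0.
Qed.

(** The product of the counts is min times max, and their sum is at most twice the max. *)
Lemma precision_ge_half_min n : 0 < n.1 -> 0 < n.2 ->
  Num.min n.1 n.2 / 2 <= precision n.
Proof.
move=> n1 n2; rewrite /precision ler_pdivlMr ?addr_gt0//.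
by case: (leP n.1 n.2) => h; nra.
Qed.

Lemma ge0_integral_gap_ratio n theta b t f : 0 < n.1 -> 0 < n.2 ->
  measurable_fun setT f -> (forall x, 0 <= f x)%E ->
  (\int[obs_law n (theta.1 + (gap_step n b t).1,
                    theta.2 + (gap_step n b t).2)%R]_x f x =
   \int[obs_law n theta]_x (f x * (expR
     (precision n * t * (gap x b - gap theta b - t / 2)))%:E))%E.
Proof.
move=> n1 n2 mf f0.
apply: etrans (ge0_integral_obs_law_ratio theta (gap_step n b t) n1 n2 mf f0) _.
by apply: eq_integral => x _; rewrite gap_step_log_ratio.
Qed.

Lemma measurable_gap_preimage b (B : set R) : measurable B ->
  measurable [set x : obs | B (gap x b)].
Proof.
by move=> mB; rewrite -[X in measurable X]setTI; exact: measurable_gap.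
Qed.

Lemma obs_law_indic n theta (E : set obs) : measurable E ->
  (obs_law n theta E = \int[obs_law n theta]_x (\1_E x)%:E)%E.
Proof. by move=> mE; exact: esym (integral_indicT (obs_law n theta) mE). Qed.

(* The observation displaced by [gap_step n b y] has the law of the displaced
   means, whose likelihood ratio is bounded where [gap x b <= h]. *)
Lemma gap_shift_le n theta b y h (B : set R) : 0 < n.1 -> 0 < n.2 ->
  0 <= y -> measurable B -> (forall z, B z -> z <= h) ->
  (obs_law n theta [set x | B (gap x b + y)%R] <=
   (expR (- (precision n * y * (gap theta b - h + y / 2))))%:E *
   obs_law n theta [set x | B (gap x b)])%E.
Proof.
move=> n1 n2 y0 mB Bh.
set K := precision n * y * _.
have mE := measurable_gap_preimage b mB.
pose f : obs -> \bar R := EFin \o \1_[set x : obs | B (gap x b)].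
have mf : measurable_fun setT f.
  by apply/measurable_EFinP; exact: measurable_indic.
have f0 x : (0 <= f x)%E by rewrite lee_fin.
have mE' : measurable [set x : obs | B (gap x b + y)].
  apply: (measurable_gap_preimage b (B := [set z | B (z + y)])).
  rewrite -[X in measurable X]setTI.
  by apply: (measurable_addr y).
pose mexp x := (expR (precision n * y * (gap x b - gap theta b - y / 2)))%:E.
have H1 : obs_law n theta [set x | B (gap x b + y)] =
  (\int[obs_law n theta]_x (f x * mexp x))%E.
  apply: etrans (obs_law_indic _ _ mE') _.
  apply/esym.
  apply: etrans (esym (ge0_integral_gap_ratio theta b y n1 n2 mf f0)) _.
  apply: etrans (ge0_integral_obs_lawD theta (gap_step n b y) n1 n2 mf f0) _.
  apply: eq_integral => x _; rewrite /f/= !indicE; congr (_%:R)%:E.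
  congr nat_of_bool.
  by apply/idP/idP; rewrite !inE/= gap_stepE.
rewrite H1.
have H2 : ((expR (- K))%:E * obs_law n theta [set x | B (gap x b)] =
   \int[obs_law n theta]_x ((expR (- K))%:E * f x))%E.
  rewrite obs_law_indic; last exact: mE.
  apply/esym; apply: ge0_integralZl; rewrite ?lee_fin ?expR_ge0//.
rewrite H2.
have mmexp : measurable_fun setT (mexp : obs -> \bar R).
  exact: measurable_gap_lr.
apply: ge0_le_integral.
- exact: measurableT.
- by move=> x _; rewrite mule_ge0// lee_fin expR_ge0.
- exact: emeasurable_funM.
- exact: emeasurable_funM.
- move=> x _; rewrite /f/= indicE; case: (boolP (x \in _)); last first.
    by rewrite mul0e mule0.
  rewrite inE/= => /Bh xh; rewrite mul1e mule1 lee_fin ler_expR.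
  have : 0 < precision n by rewrite divr_gt0 ?mulr_gt0 ?addr_gt0.
  move=> k0; rewrite /K -[leRHS]mulrN.
  apply: ler_wpM2l; first by rewrite mulr_ge0// ltW.
  by lra.
Qed.

#[local] Opaque gap_step precision.

(** * Tail bounds for the empirical gap *)

Lemma measurable_gap_le b y : measurable [set x : obs | gap x b <= y].
Proof.
rewrite (_ : mkset _ = [set x | `]-oo, y]%classic (gap x b)]); last first.
  by apply/seteqP; split => x /=; rewrite in_itv.
exact: measurable_gap_preimage (measurable_itv _).
Qed.

Lemma measurable_gap_lt0 b : measurable [set x : obs | gap x b < 0].
Proof.
rewrite (_ : mkset _ = [set x | `]-oo, 0[%classic (gap x b)]); last first.
  by apply/seteqP; split => x /=; rewrite in_itv.
exact: measurable_gap_preimage (measurable_itv _).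
Qed.

(** Chernoff bound, obtained from [gap_shift_le] on the half-line ending at the true gap, whose
    probability is then bounded by 1. *)
Lemma gap_tail n theta b t : 0 < n.1 -> 0 < n.2 -> 0 <= t ->
  (obs_law n theta [set x | (gap x b <= gap theta b - t)%R] <=
   (expR (- (precision n * t ^+ 2 / 2)))%:E)%E.
Proof.
move=> n1 n2 t0.
have Bh z : `]-oo, gap theta b]%classic z -> z <= gap theta b.
  by rewrite /= in_itv.
have mB : measurable `]-oo, gap theta b] by exact: measurable_itv.
have H := gap_shift_le theta b n1 n2 t0 mB Bh.
have -> : [set x : obs | gap x b <= gap theta b - t] =
    [set x | `]-oo, gap theta b]%classic (gap x b + t)].
  by apply/seteqP; split => x /=; rewrite in_itv/= lerBrDr.
apply: le_trans H _.
rewrite subrr add0r -mulrA -(mulrA (precision n)) expr2 -(mulrA t).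
rewrite -[leRHS]mule1; apply: lee_wpmul2l; first by rewrite lee_fin expR_ge0.
exact: (probability_le1 (obs_law n theta) (measurable_gap_preimage b mB)).
Qed.

(** A gap of at most [y] is trivial. Otherwise the gap is [y + t]: the part [y] is paid with
    probability at most 1, and [gap_tail] makes [t] times the probability at most the inverse square
    root. *)
Lemma le_gap_mul_prob n theta b y : 0 < n.1 -> 0 < n.2 -> 0 <= y ->
  0 <= gap theta b ->
  ((gap theta b)%:E * obs_law n theta [set x | (gap x b <= y)%R] <=
   (y + (Num.sqrt (Num.min n.1 n.2))^-1)%:E)%E.
Proof.
move=> n1 n2 y0 g0.
set g := gap theta b in g0 *.
set r := Num.sqrt _.
have nm0 : 0 < Num.min n.1 n.2 by rewrite lt_min n1.
have r0 : 0 < r by rewrite sqrtr_gt0.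
have rE : r ^+ 2 = Num.min n.1 n.2 by rewrite sqr_sqrtr// ltW.
have V0 : 0 <= r^-1 by rewrite invr_ge0 ltW.
have [gy|yg] := leP g y.
  apply: (@le_trans _ _ (g%:E * 1)%E).
    apply: lee_wpmul2l; first by rewrite lee_fin.
    exact: (probability_le1 (obs_law n theta) (measurable_gap_le b y)).
  by rewrite mule1 lee_fin; lra.
pose t := g - y.
have t0 : 0 <= t by rewrite subr_ge0 ltW.
have := gap_tail theta b n1 n2 t0.
rewrite -/g /t subKr => H.
apply: (@le_trans _ _ (g%:E * (expR (- (precision n * t ^+ 2 / 2)))%:E)%E).
  by apply: lee_wpmul2l; first by rewrite lee_fin.
rewrite -EFinM lee_fin expRN.
have kr := precision_ge_half_min n1 n2; rewrite -rE in kr.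
set e := expR _.
have e1 : 1 + r ^+ 2 * t ^+ 2 / 4 <= e.
  apply: le_trans (expR_ge1Dx _); rewrite lerD2l.
  have : 0 <= t ^+ 2 by rewrite sqr_ge0.
  by nra.
have e0 : 0 < e by exact: expR_gt0.
(* From the square of [1 - t * r / 2]; with [e1] it gives [t / e <= 1 / r]. *)
have tr : t * r <= 1 + r ^+ 2 * t ^+ 2 / 4.
  have := sqr_ge0 (1 - t * r / 2); nra.
have eV : e^-1 <= 1.
  rewrite invf_le1//; apply: le_trans e1.
  by rewrite lerDl divr_ge0// mulr_ge0 ?sqr_ge0.
have te : t * e^-1 <= r^-1.
  rewrite ler_pdivrMr// mulrC ler_pdivlMr//.
  exact: le_trans tr e1.
have -> : g = y + t by rewrite /t addrC subrK.
rewrite mulrDl; apply: lerD => //.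
by rewrite ler_piMr.
Qed.

Lemma gap_lt0_prob_shift n theta b t : 0 < n.1 -> 0 < n.2 ->
  (obs_law n (theta.1 + (gap_step n b t).1, theta.2 + (gap_step n b t).2)%R
     [set x | (gap x b < 0)%R] =
   \int[obs_law n theta]_x ((\1_[set x : obs | (gap x b < 0)%R] x)%:E * (expR
     (precision n * t * (gap x b - gap theta b - t / 2))%R)%:E))%E.
Proof.
move=> n1 n2.
have mE := measurable_gap_lt0 b.
apply: etrans (obs_law_indic _ _ mE) _.
apply: (ge0_integral_gap_ratio theta b t n1 n2).
  by apply/measurable_EFinP; exact: measurable_indic.
by move=> x; rewrite lee_fin.
Qed.

(* If the event were null, it would stay null after any displacement of the
   means, against [gap_tail] at an instance where [gap theta' b = -1]. *)
Lemma gap_lt0_prob_gt0 n theta b : 0 < n.1 -> 0 < n.2 ->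
  (0 < obs_law n theta [set x | (gap x b < 0)%R])%E.
Proof.
move=> n1 n2; rewrite lt0e measure_ge0 andbT.
apply/negP => /eqP P0.
(* Brings the gap to -1; the displaced means may leave the unit square, but the law is still
   Gaussian. *)
pose t := - 1 - gap theta b.
pose theta' := (theta.1 + (gap_step n b t).1, theta.2 + (gap_step n b t).2).
have g' : gap theta' b = -1 by rewrite gap_stepE// addrC subrK.
have mE := measurable_gap_lt0 b.
have P'0 : obs_law n theta' [set x | gap x b < 0] = 0%E.
  apply: etrans (gap_lt0_prob_shift theta b t n1 n2) _.
  have mf : measurable_fun [set: obs]
     (fun x => (expR (precision n * t * (gap x b - gap theta b - t / 2)))%:E).
    exact: measurable_gap_lr.
  have := null_set_integral mE (measurable_funTS mf) P0.
  rewrite integral_mkcond => H0; apply: etrans H0.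
  apply: eq_integral => x _; rewrite patchE indicE.
  by case: ifP => _; rewrite ?mul1e ?mul0e.
(* The other arm has gap 1, so a deviation of 1 bounds the complementary event by
   [expR (- (precision n / 2)) < 1], although that event has probability 1. *)
have := gap_tail theta' (~~ b) n1 n2 ler01.
rewrite gapN g' opprK subrr.
have -> : [set x : obs | gap x (~~ b) <= 0] = ~` [set x : obs | gap x b < 0].
  by apply/seteqP; split => x /=; rewrite gapN oppr_le0 leNgt => /negP.
rewrite (probability_setC (obs_law n theta') mE) [X in (1 - X)%E]P'0.
rewrite sube0 lee_fin leNgt expR_lt1 oppr_lt0 expr1n mulr1.
by rewrite !divr_gt0 ?mulr_gt0 ?addr_gt0.
Qed.

(** * Regret as gap times error probability *)

Lemma obs_lawT n theta : obs_law n theta [set: obs] = 1%E.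
Proof. exact: (probability_setT (obs_law n theta)). Qed.

Definition wrong_arm_prob n (A : algorithm R) theta b : \bar R :=
  (\int[obs_law n theta]_x A n x [set ~~ b])%E.

Lemma arm_mean_integral n (A : algorithm R) theta x b :
  (\int[A n x]_a (arm_mean theta a)%:E =
   (arm_mean theta b)%:E - (gap theta b)%:E * A n x [set ~~ b])%E.
Proof.
rewrite -(integral_indicT (A n x))//.
rewrite -integral_cst_subZ; first last.
- by move=> a; rewrite !lee_fin indicE; case: (_ \in _); rewrite /= ?lexx ler01.
- exact/measurable_EFinP/measurable_indic.
- exact: prob_kernel.
apply: eq_integral => a _; rewrite -EFinM -EFinB; congr EFin.
rewrite gap.unlock indicE.
have -> : a \in [set ~~ b] = (a == ~~ b) by apply/idP/eqP; rewrite inE.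
by case: a b => -[] /=; rewrite ?mulr1 ?subKr ?mulr0 ?subr0.
Qed.

Lemma kernel_prob01 n (A : algorithm R) x (E : set bool) :
  (0 <= A n x E <= 1)%E.
Proof.
rewrite measure_ge0/= -(prob_kernel (s := A n) x).
by apply: le_measure; rewrite ?inE.
Qed.

Lemma wrong_arm_prob01 n (A : algorithm R) theta b :
  (0 <= wrong_arm_prob n A theta b <= 1)%E.
Proof.
apply/andP; split; first by apply: integral_ge0 => x _; exact: measure_ge0.
have H1 : (\int[obs_law n theta]_x (cst 1 x) = 1)%E.
  apply: etrans (integral_cst (obs_law n theta) measurableT 1%E) _.
  by rewrite mul1e; exact: obs_lawT.
apply: (@le_trans _ _ (\int[obs_law n theta]_x (cst 1 x))%E); last by rewrite H1.
apply: ge0_le_integral.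
- exact: measurableT.
- by move=> x _; exact: measure_ge0.
- exact: measurable_kernel.
- exact: measurable_cst.
- by move=> x _; have /andP[] := kernel_prob01 n A x [set ~~ b].
Qed.

Lemma wrong_arm_prob_fin_num n (A : algorithm R) theta b :
  wrong_arm_prob n A theta b \is a fin_num.
Proof.
have /andP[i0 i1] := wrong_arm_prob01 n A theta b.
by rewrite ge0_fin_numE// (le_lt_trans i1)// ltry.
Qed.

(** With two arms, the only loss is the gap, incurred when the worse arm is drawn. On a tie either
    arm may serve as [b], and both sides are 0. *)
Lemma regretE n (A : algorithm R) theta b : 0 <= gap theta b ->
  regret n A theta = ((gap theta b)%:E * wrong_arm_prob n A theta b)%E.
Proof.
move=> g0; rewrite /regret.
have -> : Num.max theta.1 theta.2 = arm_mean theta b.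
  move: g0; rewrite gap.unlock subr_ge0.
  by case: b => /= h; [apply/max_idPl|apply/max_idPr].
have -> : (\int[obs_law n theta]_x \int[A n x]_a (arm_mean theta a)%:E =
    (arm_mean theta b)%:E - (gap theta b)%:E * wrong_arm_prob n A theta b)%E.
  apply: etrans (integral_cst_subZ _ _ (obs_lawT n theta)
    (measurable_kernel (A n) [set ~~ b] _) _).
  - by apply: eq_integral => x _; exact: arm_mean_integral.
  - by [].
  - by move=> x; exact: kernel_prob01.
rewrite -(fineK (wrong_arm_prob_fin_num n A theta b)) -EFinM.
by rewrite -!EFinB subKr.
Qed.

Lemma regret_ge0 n (A : algorithm R) theta : (0 <= regret n A theta)%E.
Proof.
have [b g0] := exists_best_arm theta.
rewrite (regretE n A g0) mule_ge0 ?lee_fin//.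
by have /andP[] := wrong_arm_prob01 n A theta b.
Qed.

(** * Algorithms favouring one arm, and their minimax optimality *)

(* The arm [b] gets a bonus [y], so that it is wrongly discarded much less
   often than by the plain comparison of the two empirical means. *)
Definition optimistic_arm y b (x : R * R) : bool :=
  if gap x b < - y then ~~ b else b.

Lemma measurable_optimistic_arm y b :
  measurable_fun [set: obs] (optimistic_arm y b).
Proof.
apply: measurable_fun_ifT; [|exact: measurable_cst|exact: measurable_cst].
by apply: measurable_fun_ltr; [exact: measurable_gap|exact: measurable_cst].
Qed.

Lemma measurable_optimistic_armE y b b' :
  measurable [set x : obs | optimistic_arm y b x = b'].
Proof.
rewrite -[X in measurable X]setTI.
have mb : measurable [set b'] by [].
exact: (measurable_optimistic_arm y b measurableT mb).
Qed.

(** A deterministic rule seen as a Dirac kernel; the counts enter only through the choice of [y]. *)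
Definition optimistic y b : algorithm R :=
  fun=> kdirac (measurable_optimistic_arm y b).

Lemma wrong_arm_prob_optimistic n theta y b b' :
  wrong_arm_prob n (optimistic y b) theta b' =
  obs_law n theta [set x | optimistic_arm y b x = ~~ b'].
Proof.
apply: etrans (esym (obs_law_indic n theta (measurable_optimistic_armE y b _))).
apply: eq_integral => x _.
rewrite /optimistic /kdirac/= /dirac !indicE.
by congr (_%:R)%:E; congr nat_of_bool.
Qed.

(** One bound covers both cases: the favoured arm is dropped only when its gap is below [- y], the
    other arm only when its gap is at most [y]. *)
Lemma wrong_arm_prob_optimistic_le n theta y b b' : 0 <= y ->
  (wrong_arm_prob n (optimistic y b) theta b' <=
   obs_law n theta [set x | (gap x b' <= y)%R])%E.
Proof.
move=> y0; rewrite wrong_arm_prob_optimistic.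
apply: le_measure; rewrite ?inE.
- exact: measurable_optimistic_armE.
- exact: measurable_gap_le.
move=> x /=; rewrite /optimistic_arm.
case: ltP => h.
  by move=> /negb_inj <-; lra.
by move=> bb'; move: h; rewrite bb' gapN; lra.
Qed.

(** The error event is that the gap shifted by [y] is negative, so [gap_shift_le] applies with
    [h = 0]; this is the exponential gain. *)
Lemma wrong_arm_prob_optimistic_same_le n theta y b :
  0 < n.1 -> 0 < n.2 -> 0 <= y ->
  (wrong_arm_prob n (optimistic y b) theta b <=
   (expR (- (precision n * y * (gap theta b + y / 2))))%:E *
   obs_law n theta [set x | (gap x b < 0)%R])%E.
Proof.
move=> n1 n2 y0; rewrite wrong_arm_prob_optimistic.
have Bh z : `]-oo, (0 : R)[%classic z -> z <= 0.
  by rewrite /= in_itv/= => /ltW.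
have := gap_shift_le theta b n1 n2 y0 (measurable_itv `]-oo, 0[) Bh.
rewrite subr0.
have -> : [set x : obs | `]-oo, (0 : R)[%classic (gap x b)] =
    [set x | gap x b < 0].
  by apply/seteqP; split => x /=; rewrite in_itv.
suff -> : [set x : obs | `]-oo, (0 : R)[%classic (gap x b + y)] =
    [set x | optimistic_arm y b x = ~~ b] by [].
apply/seteqP; split => x /=; rewrite in_itv/= /optimistic_arm -ltrBrDr sub0r.
  by move=> ->.
by case: ltP => // _ h; case: b h.
Qed.

(** [le_gap_mul_prob] bounds the worst-case regret by [c * c0 - 1] over the square root of the
    smaller count, within the allowed [c * c0] over the same root. *)
Lemma optimistic_minimax_optimal n c c0 b : 0 < n.1 -> 0 < n.2 -> 0 < c ->
  2 <= c * c0 ->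
  ((c0 / Num.sqrt (Num.min n.1 n.2))%:E <= minimax_regret n)%E ->
  @minimax_optimal R n c
    (optimistic ((c * c0 - 2) / Num.sqrt (Num.min n.1 n.2)) b).
Proof.
move=> n1 n2 c_gt0 cc0 lb; rewrite /minimax_optimal/=.
set r := Num.sqrt _ in lb *.
have r0 : 0 < r by rewrite sqrtr_gt0 lt_min n1.
apply: (@le_trans _ _ (c%:E * (c0 / r)%:E)%E); last first.
  by apply: lee_wpmul2l => //; rewrite lee_fin ltW.
apply: ge_ereal_sup => _ [theta _ <-].
have [b' g0] := exists_best_arm theta.
have y0 : 0 <= (c * c0 - 2) / r by rewrite divr_ge0 ?subr_ge0// ltW.
rewrite (regretE _ _ g0).
apply: le_trans (le_trans
  (lee_wpmul2l _ (wrong_arm_prob_optimistic_le n theta b b' y0))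
  (le_gap_mul_prob n1 n2 y0 g0)) _; first by rewrite lee_fin.
rewrite -EFinM lee_fin mulrA -[X in _ + X]mul1r -mulrDl.
by rewrite ler_pM2r ?invr_gt0//; lra.
Qed.

(** * Two-point lower bound for an arbitrary algorithm *)

(** All four terms are written as integrals under the law at [theta], with [L] the likelihood ratio
    of [theta'] to [theta], and the integrands are compared pointwise. As the gaps are 1/2 and -1/2,
    the constants in the exponent cancel and [L x = 1] exactly when the empirical gap is 0. *)
Lemma le_wrong_arm_prob_sum n (A : algorithm R) theta theta' :
  0 < n.1 -> 0 < n.2 ->
  gap theta true = 1 / 2 ->
  theta' = (theta.1 + (gap_step n false 1).1,
            theta.2 + (gap_step n false 1).2) ->
  (obs_law n theta [set x | (gap x true < 0)%R] +
   obs_law n theta' [set x | (gap x false < 0)%R] <=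
   wrong_arm_prob n A theta true + wrong_arm_prob n A theta' false)%E.
Proof.
move=> n1 n2 gt theta'E.
pose L x := expR (precision n * 1 * (gap x false - gap theta false - 1 / 2)).
have L0 x : (0 <= (L x)%:E)%E by rewrite lee_fin expR_ge0.
have mL : measurable_fun [set: obs] (EFin \o L).
  exact: measurable_gap_lr.
have mA a : measurable_fun [set: obs] (fun x => A n x [set a]).
  exact: measurable_kernel.
have A0 a x : (0 <= A n x [set a])%E by exact: measure_ge0.
have mI b : measurable_fun [set: obs]
    (fun x => (\1_[set x : obs | gap x b < 0] x)%:E : \bar R).
  by apply/measurable_EFinP; apply: measurable_indic; exact: measurable_gap_lt0.
have I0 b (x : obs) : (0 <= (\1_[set x : obs | gap x b < 0] x)%:E :> \bar R)%E.
  by rewrite lee_fin.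
have -> : wrong_arm_prob n A theta' false =
    (\int[obs_law n theta]_x (A n x [set true] * (L x)%:E))%E.
  rewrite theta'E.
  exact: (ge0_integral_gap_ratio theta false 1 n1 n2 (mA true) (A0 true)).
have -> := obs_law_indic n theta (measurable_gap_lt0 true).
have -> : obs_law n theta' [set x | gap x false < 0] =
    (\int[obs_law n theta]_x
       ((\1_[set x : obs | (gap x false < 0)%R] x)%:E * (L x)%:E))%E.
  rewrite theta'E.
  exact: (gap_lt0_prob_shift theta false 1 n1 n2).
have sumI :
  (\int[obs_law n theta]_x (\1_[set x : obs | (gap x true < 0)%R] x)%:E +
  \int[obs_law n theta]_x
     ((\1_[set x : obs | (gap x false < 0)%R] x)%:E * (L x)%:E) =
  \int[obs_law n theta]_x ((\1_[set x : obs | (gap x true < 0)%R] x)%:E +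
     (\1_[set x : obs | (gap x false < 0)%R] x)%:E * (L x)%:E))%E.
  apply/esym; apply: ge0_integralD.
  - exact: measurableT.
  - by move=> x _; exact: I0.
  - exact: mI.
  - by move=> x _; rewrite mule_ge0.
  - exact: emeasurable_funM.
have sumA : (wrong_arm_prob n A theta true +
  \int[obs_law n theta]_x (A n x [set true] * (L x)%:E) =
  \int[obs_law n theta]_x (A n x [set false] + A n x [set true] * (L x)%:E))%E.
  apply/esym; apply: ge0_integralD.
  - exact: measurableT.
  - by move=> x _; exact: A0.
  - exact: mA.
  - by move=> x _; rewrite mule_ge0.
  - exact: emeasurable_funM.
rewrite sumI sumA.
apply: ge0_le_integral.
- exact: measurableT.
- by move=> x _; rewrite adde_ge0// mule_ge0.
- by apply: emeasurable_funD; [exact: mI|exact: emeasurable_funM].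
- by apply: emeasurable_funD; [exact: mA|exact: emeasurable_funM].
move=> x _.
(* Neyman-Pearson: [L x] compares with [1] as [gap x false] compares with [0],
   so that the left-hand side is at most [min 1 (L x)]. *)
have LE : L x = expR (- (precision n * gap x true)).
  by rewrite /L -[false]/(~~ true) !gapN gt opprK; congr expR; ring.
have finA a : A n x [set a] \is a fin_num.
  rewrite ge0_fin_numE//; have /andP[_ h] := kernel_prob01 n A x [set a].
  exact: le_lt_trans h (ltry _).
have A1 : (A n x [set false] + A n x [set true] = 1)%E.
  rewrite -(prob_kernel (s := A n) x) -[LHS]measureU//.
    by congr (A n x _); apply/seteqP; split => // -[] _; [right|left].
  by apply/seteqP; split => // z [/= -> ].
have := A0 false x; have := A0 true x; move: A1.
rewrite -(fineK (finA false)) -(fineK (finA true)) -EFinD !lee_fin.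
move=> -[A1] t0 f0.
move: (fine _) (fine _) A1 t0 f0 => pf pt A1 t0 f0.
rewrite !indicE.
have mem b : (x \in [set x : obs | gap x b < 0]) = (gap x b < 0).
  by apply/idP/idP; rewrite inE.
rewrite !mem -[gap x false]/(gap x (~~ true)) gapN oppr_lt0.
have k0 : 0 < precision n by rewrite divr_gt0 ?mulr_gt0 ?addr_gt0.
have l0 : 0 < L x by exact: expR_gt0.
(* On a tie both indicators vanish. Otherwise [pf + pt * L x] is a convex combination of [1] and
   [L x], hence at least the smaller one, which is the value on the left. *)
case: ltgtP => [g|g|g] /=; last 1 first.
- by rewrite mul0r addr0 addr_ge0// mulr_ge0// ltW.
- have : 1 <= L x by rewrite LE -expR0 ler_expR oppr_ge0 pmulr_rle0// ltW.
  by nra.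
- have : L x <= 1 by rewrite LE -expR0 ler_expR oppr_le0 mulr_ge0// ltW.
  by nra.
Qed.

(** * From error probabilities to the regret ratio *)

(** The optimistic algorithm for the best arm [b] bounds the denominator from above; the gap and the
    probability of a negative empirical gap then cancel against the numerator. *)
Lemma le_regret_ratio n c y (A : algorithm R) theta b :
  0 < n.1 -> 0 < n.2 -> 0 <= y -> 0 < gap theta b ->
  @minimax_optimal R n c (optimistic y b) ->
  (obs_law n theta [set x | (gap x b < 0)%R] <= wrong_arm_prob n A theta b)%E ->
  ((expR (precision n * y * (gap theta b + y / 2)))%:E <=
   regret_ratio n c A theta)%E.
Proof.
move=> n1 n2 y0 g0 opt le_wrong.
set K := precision n * y * _.
rewrite /regret_ratio.
have lb0 : (0 <= instance_lower_bound n (@minimax_optimal R n c) theta)%E.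
  by apply: le_ereal_inf_tmp => _ [B _ <-]; exact: regret_ge0.
have lb1 : (instance_lower_bound n (@minimax_optimal R n c) theta <=
    (gap theta b)%:E * ((expR (- K))%:E *
      obs_law n theta [set x | (gap x b < 0)%R]))%E.
  apply: le_trans (ereal_inf_lbound _) _; first by exists (optimistic y b).
  rewrite (regretE _ _ (ltW g0)); apply: lee_wpmul2l.
    by rewrite lee_fin ltW.
  exact: wrong_arm_prob_optimistic_same_le.
have P0 := gap_lt0_prob_gt0 theta b n1 n2.
rewrite (regretE _ _ (ltW g0)).
have wrong_fin := wrong_arm_prob_fin_num n A theta b.
move: (wrong_arm_prob n A theta b) wrong_fin le_wrong => p.
case: p => // p _.
move: (obs_law _ _ _) P0 lb1 => r.
case: r => [r|//|//].
rewrite !lte_fin lee_fin -!EFinM => r0 lb1 rp.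
move: (instance_lower_bound _ _ _) lb0 lb1 => s.
case: s => // s; rewrite !lee_fin => s0 s1.
(* If the denominator is 0 the ratio is [+oo] and not [0 / 0 = 0], since the numerator is positive
   by [gap_lt0_prob_gt0]. *)
have [->|sn0] := eqVneq s 0.
  by rewrite inve0 gt0_muley ?leey// lte_fin mulr_gt0// (lt_le_trans r0).
have {s0 sn0}s0 : 0 < s by rewrite lt_neqAle eq_sym sn0.
rewrite inver gt_eqF// -EFinM lee_fin ler_pdivlMr//.
apply: (@le_trans _ _ (gap theta b * r)); last by rewrite ler_pM2l.
apply: le_trans (ler_wpM2l (expR_ge0 K) s1) _.
by rewrite mulrCA [expR K * _]mulrA -expRD subrr expR0 mul1r.
Qed.

End two_arms.

Theorem theorem4 (R : realType) (n : R * R) (c0 c : R) (A : algorithm R)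
    (n1_gt0 : 0 < n.1) (n2_gt0 : 0 < n.2) (c0_gt0 : 0 < c0)
    (minimax_lb :
       ((c0 / Num.sqrt (Num.min n.1 n.2))%:E <= minimax_regret n)%E)
    (c_gt : 2 / c0 < c) :
  let nmin := Num.min n.1 n.2 in
  let beta := c * c0 - 2 in
  ((nmin / (nmin + 4)
      * expR (beta ^+ 2 / 4 + beta / 4 * Num.sqrt nmin))%:E
     <= ereal_sup [set regret_ratio n c A theta | theta in @instances R])%E.
Proof.
cbv zeta; set nmin := Num.min n.1 n.2; set beta := c * c0 - 2.
have nmin0 : 0 < nmin by rewrite lt_min n1_gt0.
set r := Num.sqrt nmin.
have r0 : 0 < r by rewrite sqrtr_gt0.
have rE : r ^+ 2 = nmin by rewrite sqr_sqrtr// ltW.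
have beta0 : 0 < beta by rewrite subr_gt0 -ltr_pdivrMr.
have c_gt0 : 0 < c by apply: lt_trans c_gt; rewrite divr_gt0.
pose y := beta / r.
have y0 : 0 <= y by rewrite divr_ge0// ltW.
have opt b : @minimax_optimal R n c (optimistic y b).
  by apply: optimistic_minimax_optimal => //; rewrite -subr_ge0 ltW.
(* The amounts by which the first mean decreases and the second increases when the gap moves from
   1/2 to -1/2. *)
pose a1 := n.2 / (n.1 + n.2); pose a2 := n.1 / (n.1 + n.2).
have a1_ge0 : 0 <= a1 by rewrite divr_ge0 ?addr_ge0 ?ltW.
have a2_ge0 : 0 <= a2 by rewrite divr_ge0 ?addr_ge0 ?ltW.
have a12 : a1 + a2 = 1.
  by rewrite /a1 /a2 -mulrDl addrC divff// gt_eqF ?addr_gt0.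
(* Both instances lie in the unit square as soon as [m] is at least [a1] and [1 / 2] and at most [1]
   and [a1 + 1 / 2]; this is the least such [m]. *)
pose m := Num.max a1 (1 / 2).
pose theta : R * R := (m, m - 1 / 2).
pose theta' : R * R := (theta.1 + (gap_step n false 1).1,
                        theta.2 + (gap_step n false 1).2).
have theta'E : theta' = (m - a1, m - 1 / 2 + a2).
  by rewrite /theta' /gap_step/= /a1 /a2 !mulN1r !mulNr opprK mul1r.
have [m1 m2] : 1 / 2 <= m /\ a1 <= m by rewrite /m !le_max !lexx orbT.
have [m3 m4] : m <= 1 /\ m <= a1 + 1 / 2.
  by rewrite /m !ge_max; split; apply/andP; split; lra.
have inst : instances theta.
  by split; rewrite /= in_itv/=; apply/andP; split; lra.
have inst' : instances theta'.
  by rewrite theta'E; split; rewrite /= in_itv/=; apply/andP; split; lra.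
have g : gap theta true = 1 / 2 by rewrite gap.unlock/=; lra.
have g' : gap theta' false = 1 / 2.
  by rewrite theta'E gap.unlock/=; lra.
have [b [th [inst_th gth le_wrong]]] : exists b th, [/\ instances th,
    gap th b = 1 / 2 &
    (obs_law n th [set x | (gap x b < 0)%R] <= wrong_arm_prob n A th b)%E].
  have [h|h] := leeD_or (le_wrong_arm_prob_sum A n1_gt0 n2_gt0 g (erefl theta')).
    by exists true, theta; split; [exact: inst|exact: g|exact: h].
  by exists false, theta'; split; [exact: inst'|exact: g'|exact: h].
apply: le_trans (ereal_sup_ubound _); last by exists th.
have g0 : 0 < gap th b by rewrite gth.
apply: le_trans (le_regret_ratio n1_gt0 n2_gt0 y0 g0 (opt b) le_wrong).
rewrite lee_fin gth.
(* The prefactor is at most 1, so it suffices to bound the exponential. *)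
have frac : nmin / (nmin + 4) <= 1.
  by rewrite ler_pdivrMr ?addr_gt0// mul1r lerDl.
apply: (@le_trans _ _ (expR (beta ^+ 2 / 4 + beta / 4 * r))).
  by rewrite ler_piMl// expR_ge0.
rewrite ler_expR.
(* The target exponent is the one of [le_regret_ratio] at gap 1/2, with [precision n] replaced by
   its lower bound [nmin / 2]. *)
have -> : beta ^+ 2 / 4 + beta / 4 * r = nmin / 2 * y * (1 / 2 + y / 2).
  by rewrite /y -rE; field; rewrite gt_eqF.
apply: ler_wpM2r; first by rewrite addr_ge0// divr_ge0.
exact: ler_wpM2r y0 _ _ (precision_ge_half_min n1_gt0 n2_gt0).
Qed.
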